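(* Let $\mathbb{M}\in\{\mathbb{A},\mathbb{S},\mathbb{D}\}$ and $0\le r\le\infty$. Every $C^r$-AbC scheme $(U,\nu)$ on $\mathbb{M}$ is a $C^r$-AbC$^\star$ scheme. In particular, if a property $(\mathcal{P})$ on $\mathrm{Symp}^r(\mathbb{M})$ is an AbC realizable $C^r$-property, then it is an AbC$^\star$ realizable $C^r$-property.
   Context: Surfaces. $\mathbb{T}=\mathbb{R}/\mathbb{Z}$, $\mathbb{I}=[-1,1]$; $\mathbb{M}$ is one of the cylinder $\mathbb{A}=\mathbb{T}\times\mathbb{I}$, the closed unit disk $\mathbb{D}\subset\mathbb{R}^2$, the unit sphere $\mathbb{S}\subset\mathbb{R}^3$, with its canonical symplectic form $\Omega$ normalized to total area $1$. For $\alpha\in\mathbb{T}$, $R_\alpha$ is the rotation of $\mathbb{M}$ by $\alpha$ turns: $(\theta,y)\mapsto(\theta+\alpha,y)$ on $\mathbb{A}$, rotation about the center on $\mathbb{D}$, rotation about the $x_3$-axis on $\mathbb{S}$. The continuous surjection $\pi:\mathbb{A}\to\mathbb{M}$ is $\pi(\theta,y)=(\theta,y)$ if $\mathbb{M}=\mathbb{A}$, $(\sqrt{1-y^2}\cos 2\pi\theta,\sqrt{1-y^2}\sin 2\pi\theta,y)$ if $\mathbb{M}=\mathbb{S}$, $\sqrt{(1+y)/2}\,(\cos 2\pi\theta,\sin 2\pi\theta)$ if $\mathbb{M}=\mathbb{D}$. Set $\check{\mathbb{M}}=\pi(\mathbb{T}\times(-1,1))$, $\partial\check{\mathbb{M}}=\mathbb{M}\setminus\check{\mathbb{M}}$,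 and for $\eta\in[0,1)$, $\mathbb{M}(\eta)=\pi(\mathbb{T}\times(-1+\eta,1-\eta))$. For $1\le r\le\infty$, $\mathrm{Symp}^r(\mathbb{M})$ is the space of $C^r$ symplectomorphisms with the $C^r$ topology; $\mathrm{Symp}^0(\mathbb{M})$ is the $C^0$-closure of $\mathrm{Symp}^1(\mathbb{M})$. $\mathrm{Symp}^r(\mathbb{M};\partial\check{\mathbb{M}})$ is the subset of maps equal to the identity on $\partial\check{\mathbb{M}}$. $d_{C^s}$ is a distance inducing the $C^s$ topology. AbC scheme. $\mathcal{T}^r$ is the topology on $\mathrm{Symp}^r(\mathbb{M};\partial\check{\mathbb{M}})$ with basis of neighbourhoods of $f$ the sets $\{g:d_{C^s}(f|_{\mathbb{M}(\eta)},g|_{\mathbb{M}(\eta)})<\epsilon\}$, $\eta,\epsilon>0$, finite $s\le r$. A $C^r$-AbC scheme is a map $(h,\alpha)\in\mathrm{Symp}^r(\mathbb{M};\partial\check{\mathbb{M}})\times\mathbb{Q}/\mathbb{Z}\mapsto(U(h,\alpha),\nu(h,\alpha))\in\mathcal{T}^r\times(0,\infty)$ such that: (i) each $U(h,\alpha)$ contains a map $\hat h\in\mathrm{Symp}^r(\mathbb{M};\partial\check{\mathbb{M}})$ with $\hat h\circ R_\alpha\circ\hat h^{-1}=h\circ R_\alpha\circ h^{-1}$; (ii) for any sequences $(h_n)$ in $\mathrm{Symp}^r(\mathbb{M};\partial\check{\mathbb{M}})$ and $(\alpha_n)$ in $\mathbb{Q}/\mathbb{Z}$ with $h_0=\mathrm{id}$,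 $\alpha_0=0$ and, for all $n\ge0$, $h_{n+1}R_{\alpha_n}h_{n+1}^{-1}=h_nR_{\alpha_n}h_n^{-1}$, $h_{n+1}\in U(h_n,\alpha_n)$ and $0<|\alpha_{n+1}-\alpha_n|<\nu(h_{n+1},\alpha_n)$, the sequence $f_n=h_nR_{\alpha_n}h_n^{-1}$ converges to some $f\in\mathrm{Symp}^r(\mathbb{M})$. Such $f$ is said to be constructed from the scheme. Bicurves. A bicurve on $\mathbb{A}$ is the union $\gamma$ of two disjoint embedded loops $\gamma_+,\gamma_-$ such that there are $-1\le y_-<y_+\le1$ and a diffeotopy $(f_t)_{t\in[0,1]}$ of $\mathbb{A}$ by $C^\infty$ diffeomorphisms, compactly supported in $\mathbb{A}\setminus\partial\mathbb{A}$, with $f_0=\mathrm{id}$ and $f_1(\mathbb{T}\times\{y_\pm\})=\gamma_\pm$. $\Gamma_2(\mathbb{A})$ is the set of bicurves on $\mathbb{A}$ and $\Gamma_2(\mathbb{M})=\{\pi(\gamma):\gamma\in\Gamma_2(\mathbb{A})\}$. For $\gamma\in\Gamma_2(\mathbb{M})$, $\kappa>0$: $B(\gamma,\kappa)=\{x\in\mathbb{M}:d(x,\gamma)<\kappa\}$; $A(\gamma)$ is the component of $\mathbb{M}\setminus\gamma$ with boundary $\gamma$ (the part between the two curves); $O(\gamma)=\mathbb{M}\setminus(\gamma\cup A(\gamma))$. AbC$^\star$ scheme. $\mathcal{T}^r_\gamma$ is the topology on $\mathrm{Symp}^r(\mathbb{M};\partial\check{\mathbb{M}})$ with basis of neighbourhoods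 of $f$ the sets $\{g: d_{C^s}(g|_{\mathbb{M}\setminus B(\gamma,\kappa)},f|_{\mathbb{M}\setminus B(\gamma,\kappa)})<\epsilon\}$, $\epsilon,\kappa>0$, finite $s\le r$; $\mathcal{T}^r_\Gamma=\bigcup_{\gamma\in\Gamma_2(\mathbb{M})}\mathcal{T}^r_\gamma$ (a set of subsets). A $C^r$-AbC$^\star$ scheme is a map $(h,\alpha)\in\mathrm{Symp}^r(\mathbb{M};\partial\check{\mathbb{M}})\times\mathbb{Q}/\mathbb{Z}\mapsto(U(h,\alpha),\nu(h,\alpha))\in\mathcal{T}^r_\Gamma\times(0,\infty)$ such that: (a) each $U(h,\alpha)$ contains a map $\hat h$ with $\hat hR_\alpha\hat h^{-1}=hR_\alpha h^{-1}$; (b) there exists $\gamma\in\Gamma_2(\mathbb{M})$ invariant under $R_\alpha$ such that $U(h,\alpha)\in\mathcal{T}^r_\gamma$ and $\hat h|_{O(\gamma)}=h|_{O(\gamma)}$; (c) the same convergence condition as (ii) holds for $(U,\nu)$. The limits $f$ in (c) are said to be constructed from the scheme. Realizable property. A property $(\mathcal{P})$ on $\mathrm{Symp}^r(\mathbb{M})$ is an AbC (resp. AbC$^\star$) realizable $C^r$-property if (1) it is invariant under $\mathrm{Symp}^r(\mathbb{M})$-conjugacy, and (2) there is a $C^r$-AbC (resp. $C^r$-AbC$^\star$) scheme such that every $f\in\mathrm{Symp}^r(\mathbb{M})$ constructed from it satisfies $(\mathcal{P})$. *)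

(* Defs.v *)
From HB Require Import structures.
From mathcomp Require Import all_boot all_order all_algebra ring_quotient.
From mathcomp Require Import all_classical all_reals all_analysis.
From mathcomp Require Import ring lra.

Set Implicit Arguments.
Unset Strict Implicit.
Unset Printing Implicit Defensive.

Import Order.TTheory GRing.Theory Num.Theory.
Import numFieldNormedType.Exports.

Local Open Scope classical_set_scope.
Local Open Scope ring_scope.
Local Open Scope quotient_scope.

Definition integer (R : realType) : {pred R} := fun x => x \is a Num.int.

Lemma integer_zmod_closed (R : realType) : zmod_closed (@integer R).
Proof. by split=> [|x y]; [exact: rpred0 | exact: rpredB]. Qed.

HB.instance Definition _ (R : realType) :=
  GRing.isZmodClosed.Build R (@integer R) (integer_zmod_closed R).

(* The additive group R/Z. *)
Definition torus (R : realType) : zmodType := Quotient.quot (@integer R).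

Section Angles.
Context {R : realType}.

Definition turn (x : R) : torus R := \pi_(Quotient.quot (@integer R)) x.

Definition cosT (a : torus R) : R := cos (2 * pi * repr a).
Definition sinT (a : torus R) : R := sin (2 * pi * repr a).

(* Distance to 0 for the quotient distance of R/Z. *)
Definition normT (a : torus R) : R := inf [set `|x| | x in [set x | turn x = a]].

End Angles.

(* Q/Z as a subgroup of R/Z. *)
Definition QZ (R : realType) : set (torus R) := [set turn (ratr q) | q in [set: rat]].
Arguments QZ R : clear implicits.

Inductive surface := Cylinder | Disk | Sphere.

Section Vectors.
Context {R : realType}.

Definition vec2 (a b : R) : 'rV[R]_2 := \row_(j < 2) nth 0 [:: a; b] j.
Definition vec3 (a b c : R) : 'rV[R]_3 := \row_(j < 3) nth 0 [:: a; b; c] j.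
Definition sqnorm n (x : 'rV[R]_n) : R := \sum_(j < n) x 0 j ^+ 2.

Lemma sqnorm_vec2 a b : sqnorm (vec2 a b) = a ^+ 2 + b ^+ 2.
Proof. by rewrite /sqnorm !big_ord_recr big_ord0 /= !mxE /= add0r. Qed.

Lemma sqnorm_vec3 a b c : sqnorm (vec3 a b c) = a ^+ 2 + b ^+ 2 + c ^+ 2.
Proof. by rewrite /sqnorm !big_ord_recr big_ord0 /= !mxE /= add0r. Qed.

Lemma sqnorm2E (x : 'rV[R]_2) : sqnorm x = x 0 0 ^+ 2 + x 0 1 ^+ 2.
Proof.
rewrite /sqnorm !big_ord_recr big_ord0 /= add0r.
by congr (x 0 _ ^+ 2 + x 0 _ ^+ 2); apply/val_inj.
Qed.

Lemma sqnorm3E (x : 'rV[R]_3) : sqnorm x = x 0 0 ^+ 2 + x 0 1 ^+ 2 + x 0 2 ^+ 2.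
Proof.
rewrite /sqnorm !big_ord_recr big_ord0 /= add0r.
by congr (x 0 _ ^+ 2 + x 0 _ ^+ 2 + x 0 _ ^+ 2); apply/val_inj.
Qed.

Lemma cos2Dsin2T (a : torus R) : cosT a ^+ 2 + sinT a ^+ 2 = 1.
Proof. exact: cos2Dsin2. Qed.

End Vectors.

Definition segment (R : realType) : set R := [set y | -1 <= y <= 1].
Definition unit_disk (R : realType) : set 'rV[R]_2 := [set x | sqnorm x <= 1].
Definition unit_sphere (R : realType) : set 'rV[R]_3 := [set x | sqnorm x = 1].

Arguments segment R : clear implicits.
Arguments unit_disk R : clear implicits.
Arguments unit_sphere R : clear implicits.

Definition pts_choiceType (R : realType) (M : surface) : choiceType :=
  match M with
  | Cylinder => (torus R * segment R)%type
  | Disk => unit_disk R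
  | Sphere => unit_sphere R
  end.

Definition pts (R : realType) (M : surface) : Type := pts_choiceType R M.

HB.instance Definition _ (R : realType) (M : surface) :=
  Choice.copy (pts R M) (pts_choiceType R M).

(* The differentiable structure, the topology and the distance of each surface
   are those induced by the following embedding in R^3. For the cylinder, R/Z
   is embedded as the unit circle. The norm of R^3 is the sup norm; the
   topologies below do not depend on the choice of a norm. *)
Definition emb (R : realType) (M : surface) : pts R M -> 'rV[R]_3 :=
  match M return pts R M -> 'rV[R]_3 with
  | Cylinder => fun x => vec3 (cosT x.1) (sinT x.1) (\val x.2)
  | Disk => fun x => vec3 ((\val x) 0 0) ((\val x) 0 1) 0
  | Sphere => fun x => \val x
  end.

HB.instance Definition _ (R : realType) (M : surface) :=
  Topological.copy (pts R M) (initial_topology (@emb R M)).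

Section Surfaces.
Context {R : realType}.

Lemma rot_disk_subproof (a : torus R) (x : 'rV[R]_2) : unit_disk R x ->
  unit_disk R (vec2 (cosT a * x 0 0 - sinT a * x 0 1) (sinT a * x 0 0 + cosT a * x 0 1)).
Proof.
rewrite /unit_disk /= sqnorm_vec2 sqnorm2E => h; have e := cos2Dsin2T a.
suff -> : (cosT a * x 0 0 - sinT a * x 0 1) ^+ 2 +
  (sinT a * x 0 0 + cosT a * x 0 1) ^+ 2 =
  (cosT a ^+ 2 + sinT a ^+ 2) * (x 0 0 ^+ 2 + x 0 1 ^+ 2) by rewrite e mul1r.
by ring.
Qed.

Lemma rot_sphere_subproof (a : torus R) (x : 'rV[R]_3) : unit_sphere R x ->
  unit_sphere R (vec3 (cosT a * x 0 0 - sinT a * x 0 1)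
                    (sinT a * x 0 0 + cosT a * x 0 1) (x 0 2)).
Proof.
rewrite /unit_sphere /= sqnorm_vec3 sqnorm3E => <-; have e := cos2Dsin2T a.
suff -> : (cosT a * x 0 0 - sinT a * x 0 1) ^+ 2 +
  (sinT a * x 0 0 + cosT a * x 0 1) ^+ 2 =
  (cosT a ^+ 2 + sinT a ^+ 2) * (x 0 0 ^+ 2 + x 0 1 ^+ 2) by rewrite e mul1r.
by ring.
Qed.

Definition rotation (M : surface) (a : torus R) : pts R M -> pts R M :=
  match M return pts R M -> pts R M with
  | Cylinder => fun x => (x.1 + a, x.2)
  | Disk => fun x => SigSub (mem_set (rot_disk_subproof a (set_valP x)))
  | Sphere => fun x => SigSub (mem_set (rot_sphere_subproof a (set_valP x)))
  end.

Lemma proj_disk_subproof (t : torus R) (y : R) : segment R y ->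
  unit_disk R (Num.sqrt ((1 + y) / 2) *: vec2 (cosT t) (sinT t)).
Proof.
rewrite /segment /unit_disk /= => /andP[y1 y2].
rewrite sqnorm2E !mxE /= !exprMn -mulrDr cos2Dsin2T mulr1 sqr_sqrtr; lra.
Qed.

Lemma proj_sphere_subproof (t : torus R) (y : R) : segment R y ->
  unit_sphere R (vec3 (Num.sqrt (1 - y ^+ 2) * cosT t) (Num.sqrt (1 - y ^+ 2) * sinT t) y).
Proof.
rewrite /segment /unit_sphere /= => /andP[y1 y2].
rewrite sqnorm_vec3 !exprMn -mulrDr cos2Dsin2T mulr1 sqr_sqrtr; last by nra.
by rewrite subrK.
Qed.

Definition projM (M : surface) : pts R Cylinder -> pts R M :=
  match M return pts R Cylinder -> pts R M with
  | Cylinder => id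
  | Disk => fun x => SigSub (mem_set (proj_disk_subproof x.1 (set_valP x.2)))
  | Sphere => fun x => SigSub (mem_set (proj_sphere_subproof x.1 (set_valP x.2)))
  end.

Variable M : surface.

Definition core (eta : R) : set (pts R M) :=
  projM M @` [set x | -1 + eta < \val x.2 < 1 - eta].

Definition checkM : set (pts R M) := projM M @` [set x | -1 < \val x.2 < 1].
Definition bdM : set (pts R M) := ~` checkM.

(* A normal field along M, and the area form of total area 1 that it defines
   together with the determinant of R^3: the areas of the three embedded
   surfaces are 4 pi, pi and 4 pi. *)
Definition normal (x : pts R M) : 'rV[R]_3 :=
  match M with
  | Cylinder => vec3 (emb x 0 0) (emb x 0 1) 0
  | Disk => vec3 0 0 1
  | Sphere => emb x
  end.

Definition area : R := match M with Disk => pi | _ => 4 * pi end.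

Definition Omega (x : pts R M) (u v : 'rV[R]_3) : R :=
  \det (\matrix_(i < 3) nth 0 [:: normal x; u; v] i) / area.

Definition tangent (x : pts R M) : set 'rV[R]_3 := [set u | u *m (normal x)^T = 0].

End Surfaces.

Arguments core {R} M eta _.
Arguments checkM {R} M _.
Arguments bdM {R} M _.

(* Orders of differentiability: [Some k] is k, [None] is infinity. *)
Definition le_order (s : nat) (r : option nat) : bool :=
  if r is Some k then (s <= k)%N else true.

Section Smooth.
Context {R : realType}.

Fixpoint Ck (V W : normedModType R) (k : nat) (F : V -> W) : Prop :=
  match k with
  | 0 => continuous F
  | k'.+1 => (forall x, differentiable F x) /\ (forall v, Ck k' ('D_v F))
  end.

Definition Cr (V W : normedModType R) (r : option nat) (F : V -> W) : Prop :=
  forall k, le_order k r -> Ck k F.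

Fixpoint iter_partial (l : seq 'I_3) (F : 'rV[R]_3 -> 'rV[R]_3) :=
  match l with
  | [::] => F
  | i :: l' => 'D_(delta_mx 0 i) (iter_partial l' F)
  end.

Variable M : surface.

Definition extends (F : 'rV[R]_3 -> 'rV[R]_3) (f : pts R M -> pts R M) :=
  forall x, F (emb x) = emb (f x).

(* As M is a compact submanifold (with boundary) of R^3, a map of M is C^r
   if and only if it is the restriction of a C^r map of R^3. *)
Definition Cr_map (r : option nat) (f : pts R M -> pts R M) : Prop :=
  exists2 F, Cr r F & extends F f.

Definition inv_map (f : pts R M -> pts R M) : pts R M -> pts R M :=
  fun y => xget y (f @^-1` [set y]).

(* A homeomorphism when r = 0. *)
Definition diffeo (r : option nat) (f : pts R M -> pts R M) : Prop :=
  [/\ bijective f, Cr_map r f & Cr_map r (inv_map f)].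

(* The C^s distance between f and g on K: the quotient C^s norm of f - g, that
   is, the infimum over the C^s extensions F of f - g to R^3 of the supremum on
   K of the partial derivatives of F of order at most s. Extending f - g
   constantly along the normals to M shows that it is equivalent to the supremum
   on K of the derivatives of f - g along M of order at most s. *)
Definition distC (s : nat) (K : set (pts R M)) (f g : pts R M -> pts R M) : \bar R :=
  ereal_inf [set
    ereal_sup (0%E |` [set `|iter_partial lx.1 F (emb lx.2)|%:E |
                         lx in [set lx | (size lx.1 <= s)%N /\ K lx.2]])
  | F in [set F : 'rV[R]_3 -> 'rV[R]_3 |
           Ck s F /\ forall x, F (emb x) = emb (f x) - emb (g x)]].

Definition cvgC (r : option nat) (u : nat -> pts R M -> pts R M)
    (f : pts R M -> pts R M) : Prop :=
  forall s, le_order s r -> distC s [set: pts R M] (u n) f @[n --> \oo] --> 0%E.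

Definition preserves_Omega (f : pts R M -> pts R M) : Prop :=
  exists F, [/\ Ck 1 F, extends F f &
    forall x u v, tangent x u -> tangent x v ->
      Omega (f x) ('D_u F (emb x)) ('D_v F (emb x)) = Omega x u v].

End Smooth.

(* For r = 0, the C^0-closure is taken among the homeomorphisms of M, so that
   elements of Symp^0 are invertible. *)
Definition Symp (R : realType) (M : surface) (r : option nat) :
    set (pts R M -> pts R M) :=
  if r == Some 0%N then
    [set f | diffeo (Some 0%N) f /\
       forall eps : R, 0 < eps -> exists2 g,
         diffeo (Some 1%N) g /\ preserves_Omega g &
         (distC 0 [set: pts R M] f g < eps%:E)%E]
  else [set f | diffeo r f /\ preserves_Omega f].

Arguments Symp R M r : clear implicits.

Definition Symp_rel (R : realType) (M : surface) (r : option nat) :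
    set (pts R M -> pts R M) :=
  [set f | Symp R M r f /\ forall x, bdM M x -> f x = x].

Arguments Symp_rel R M r : clear implicits.

Section Bicurves.
Context {R : realType}.
Local Notation cyl := (pts R Cylinder).

Definition diffeotopy (f : R -> cyl -> cyl) : Prop :=
  [/\ exists2 F : R^o * 'rV[R]_3 -> 'rV[R]_3, Cr None F &
        forall t x, 0 <= t <= 1 -> F (t, emb x) = emb (f t x),
      forall t, 0 <= t <= 1 -> diffeo None (f t) &
      exists K : set cyl, [/\ compact K, K `<=` checkM Cylinder &
        forall t x, 0 <= t <= 1 -> ~ K x -> f t x = x]].

Definition level (y : R) : set cyl := [set x | \val x.2 = y].

Definition bicurve_cyl (gamma : set cyl) : Prop :=
  exists ym yp : R, exists f : R -> cyl -> cyl,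
    [/\ -1 <= ym, ym < yp, yp <= 1, diffeotopy f & f 0 = id /\
        gamma = f 1 @` level yp `|` f 1 @` level ym].

Variable M : surface.

Definition bicurve (gamma : set (pts R M)) : Prop :=
  exists2 gamma', bicurve_cyl gamma' & gamma = projM M @` gamma'.

Definition tube (gamma : set (pts R M)) (kappa : R) : set (pts R M) :=
  [set x | exists2 z, gamma z & `|emb x - emb z| < kappa].

Definition frontier (A : set (pts R M)) : set (pts R M) :=
  closure A `\` interior A.

(* The component of the complement of gamma whose boundary is gamma. *)
Definition between (gamma : set (pts R M)) : set (pts R M) :=
  [set x | (~` gamma) x /\ frontier (connected_component (~` gamma) x) = gamma].

Definition outside (gamma : set (pts R M)) : set (pts R M) :=
  ~` (gamma `|` between gamma).

End Bicurves.

Section Schemes.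
Context {R : realType} {M : surface} {r : option nat}.
Local Notation symp := (set_type (Symp R M r)).
Local Notation symp_rel := (set_type (Symp_rel R M r)).

(* Open sets of the topology with neighbourhood bases
   {g | d_{C^s}(f|K, g|K) < eps}, for K in Ks, eps > 0 and finite s <= r. *)
Definition open_on (Ks : set (set (pts R M))) (U : set symp_rel) : Prop :=
  forall f, U f -> exists K s (eps : R),
    [/\ Ks K, le_order s r, 0 < eps &
        forall g : symp_rel, (distC s K (\val f) (\val g) < eps%:E)%E -> U g].

Definition T_AbC : set (set symp_rel) :=
  open_on [set core M eta | eta in [set eta | 0 < eta < 1]].

Definition T_bicurve (gamma : set (pts R M)) : set (set symp_rel) :=
  open_on [set ~` tube gamma kappa | kappa in [set kappa | 0 < kappa]].

Definition T_Gamma : set (set symp_rel) :=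
  \bigcup_(gamma in @bicurve R M) T_bicurve gamma.

Definition conj_rot (h : symp_rel) (a : QZ R) : pts R M -> pts R M :=
  \val h \o rotation (\val a) \o inv_map (\val h).

Variables (U : symp_rel -> QZ R -> set symp_rel) (nu : symp_rel -> QZ R -> R).

Definition admissible (h : nat -> symp_rel) (a : nat -> QZ R) : Prop :=
  [/\ \val (h 0%N) = id, \val (a 0%N) = 0 &
    forall n, [/\ conj_rot (h n.+1) (a n) = conj_rot (h n) (a n),
                  U (h n) (a n) (h n.+1) &
                  0 < normT (\val (a n.+1) - \val (a n)) < nu (h n.+1) (a n)]].

Definition limit_of (h : nat -> symp_rel) (a : nat -> QZ R) (f : symp) : Prop :=
  cvgC r (fun n => conj_rot (h n) (a n)) (\val f).

Definition convergent : Prop :=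
  forall h a, admissible h a -> exists f, limit_of h a f.

Definition constructed (f : symp) : Prop :=
  exists h a, admissible h a /\ limit_of h a f.

Definition AbC_scheme : Prop :=
  [/\ forall h a, T_AbC (U h a) /\ 0 < nu h a,
      forall h a, exists2 h', U h a h' & conj_rot h' a = conj_rot h a &
      convergent].

Definition AbC_star_scheme : Prop :=
  [/\ forall h a, T_Gamma (U h a) /\ 0 < nu h a,
      forall h a, exists h', [/\ U h a h', conj_rot h' a = conj_rot h a &
        exists gamma, [/\ bicurve gamma, rotation (\val a) @` gamma = gamma,
          T_bicurve gamma (U h a) &
          forall x, outside gamma x -> \val h' x = \val h x]] &
      convergent].

End Schemes.

Section Realizable.
Context {R : realType} {M : surface} {r : option nat}.
Local Notation symp := (set_type (Symp R M r)).

Definition conj_invariant (P : set symp) : Prop :=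
  forall f f' g : symp, \val f' = \val g \o \val f \o inv_map (\val g) -> P f -> P f'.

Definition AbC_realizable (P : set symp) : Prop :=
  conj_invariant P /\
  exists U nu, @AbC_scheme R M r U nu /\ (forall f, constructed U nu f -> P f).

Definition AbC_star_realizable (P : set symp) : Prop :=
  conj_invariant P /\
  exists U nu, @AbC_star_scheme R M r U nu /\ (forall f, constructed U nu f -> P f).

End Realizable.

(* Main.v *)
Require Import Defs.
From mathcomp Require Import all_boot all_order all_algebra ring_quotient.
From mathcomp Require Import all_classical all_reals all_analysis.
From mathcomp Require Import ring lra.

(** The bicurve that makes every scheme a star scheme is the extremal one,
    gamma = pi(T x {-1, 1}): the two boundary circles of the cylinder, the two
    poles of the sphere, the center and the boundary circle of the disk. It
    comes from the constant diffeotopy and it is invariant under every rotation,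
    so a single gamma serves all pairs (h, alpha).

    Two facts remain. First, the core M(eta) stays at positive distance from
    gamma, because the height function y, read on M, is Lipschitz
    ([height_lipschitz]) and separates the core from gamma. Since the C^s
    distance over a set increases with the set, closeness away from a thin tube
    around gamma forces closeness on a given core, and every open set of the
    AbC topology is open for the topology attached to gamma
    ([T_AbC_T_bicurve]). Second, the exterior O(gamma) is empty
    ([outside_extremal_bicurve]), so the requirement that the new conjugacy
    coincide with the old one on O(gamma) is vacuous. The emptiness amounts to
    A(gamma) being the whole complement of gamma, that is, to this complement
    being connected, open and dense. Connectedness and density both follow from
    one family of arcs ([spiral]), which join a base point to any given point of
    M and meet gamma at most at their end. The convergence requirements of the
    two notions are the same, and so are the maps that they construct. *)

Set Implicit Arguments.
Unset Strict Implicit.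
Unset Printing Implicit Defensive.

Import Order.TTheory GRing.Theory Num.Theory.
Import numFieldNormedType.Exports.

Local Open Scope classical_set_scope.
Local Open Scope ring_scope.
Local Open Scope quotient_scope.

(** * Angles modulo one turn *)

Section Angles.
Context {R : realType}.
Implicit Types (x y : R) (a b t : torus R).

Lemma periodic_int (f : R -> R) T : periodic f T ->
  forall (m : int) x, f (x + T *~ m) = f x.
Proof.
move=> fT [n|n] x; first exact: periodicn.
by rewrite -[LHS](periodicn fT n.+1) NegzE mulrNz subrK.
Qed.

Lemma turn_repr t : turn (repr t) = t. Proof. exact: reprK. Qed.

Lemma turnD x y : turn (x + y) = turn x + turn y.
Proof. exact: (Quotient.pi_add (@integer R) x y). Qed.

(** The representative chosen by the quotient is arbitrary; periodicity of sine
    and cosine then removes this ambiguity from [cosT] and [sinT]. *)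
Lemma repr_turn x : exists m : int, repr (turn x) = x + m%:~R.
Proof.
have /intrP[m em] : repr (turn x) - x \is a Num.int.
  have /eqP := turn_repr (turn x).
  by rewrite -Quotient.idealrBE.
by exists m; rewrite -em addrCA subrr addr0.
Qed.

Lemma cosT_turn x : cosT (turn x) = cos (2 * pi * x).
Proof.
rewrite /cosT; have [m ->] := repr_turn x.
rewrite -(periodic_int (@cosD2pi R) m (2 * pi * x)); congr cos.
by rewrite mulrDr mulrzr mulr_natl.
Qed.

Lemma sinT_turn x : sinT (turn x) = sin (2 * pi * x).
Proof.
rewrite /sinT; have [m ->] := repr_turn x.
rewrite -(periodic_int (@sinD2pi R) m (2 * pi * x)); congr sin.
by rewrite mulrDr mulrzr mulr_natl.
Qed.

Lemma cosTD a b : cosT (a + b) = cosT a * cosT b - sinT a * sinT b.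
Proof.
by rewrite -[a]turn_repr -[b]turn_repr -turnD !cosT_turn !sinT_turn mulrDr cosD.
Qed.

Lemma sinTD a b : sinT (a + b) = sinT a * cosT b + cosT a * sinT b.
Proof.
by rewrite -[a]turn_repr -[b]turn_repr -turnD !cosT_turn !sinT_turn mulrDr sinD.
Qed.

Lemma circle_angle x y : x ^+ 2 + y ^+ 2 = 1 ->
  exists t : torus R, cosT t = x /\ sinT t = y.
Proof.
move=> xy1; have x1 : -1 <= x <= 1 by apply/andP; split; nra.
have key u : cos u = x -> sin u = y -> exists t : torus R, cosT t = x /\ sinT t = y.
  move=> cu su; exists (turn (u / (2 * pi))); rewrite cosT_turn sinT_turn.
  by rewrite mulrC divfK ?mulf_neq0 ?gt_eqF ?pi_gt0.
have cx : cos (acos x) = x by apply: acosK; rewrite in_itv.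
have sx : sin (acos x) = `|y|.
  by rewrite sin_acos// -sqrtr_sqr; congr Num.sqrt; lra.
have [y0|y0] := leP 0 y; first by apply: (key (acos x)); rewrite // sx ger0_norm.
by apply: (key (- acos x)); rewrite ?cosN// sinN sx ltr0_norm ?opprK.
Qed.

Lemma polar_coordinates x y : exists t : torus R,
  Num.sqrt (x ^+ 2 + y ^+ 2) * cosT t = x /\ Num.sqrt (x ^+ 2 + y ^+ 2) * sinT t = y.
Proof.
set d := x ^+ 2 + y ^+ 2.
have [d0|d0] := eqVneq d 0.
  have /andP[/eqP-> /eqP->] : (x == 0) && (y == 0).
    by rewrite -[x == 0]sqrf_eq0 -[y == 0]sqrf_eq0 -paddr_eq0 ?sqr_ge0// -/d d0.
  by exists 0; rewrite d0 sqrtr0 !mul0r.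
have dp : 0 < d by rewrite lt_neqAle eq_sym d0 addr_ge0 ?sqr_ge0.
have s0 : Num.sqrt d != 0 by rewrite sqrtr_eq0 -ltNge.
have [|t [ct st]] := @circle_angle (x / Num.sqrt d) (y / Num.sqrt d).
  by rewrite !exprMn -mulrDl exprVn sqr_sqrtr ?(ltW dp)// divff.
by exists t; rewrite ct st; split; rewrite mulrC divfK.
Qed.

End Angles.

(** * The embedding in space *)

Section Coordinates.
Context {R : realType}.

Lemma vec3_continuous (X : topologicalType) (f g h : X -> R) :
  continuous f -> continuous g -> continuous h ->
  continuous (fun s => vec3 (f s) (g s) (h s)).
Proof.
move=> cf cg ch.
have -> : (fun s => vec3 (f s) (g s) (h s)) = fun s =>
    f s *: delta_mx 0 0 + g s *: delta_mx 0 1 + h s *: delta_mx 0 2.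
  apply/funext => s; apply/rowP => j; rewrite !mxE.
  by case: j => -[|[|[|//]]] j3; rewrite /= ?mulr1 ?mulr0 ?addr0 ?add0r.
by move=> s; apply: cvgD; first apply: cvgD; apply: cvgZ (cvg_cst _);
  [exact: cf | exact: cg | exact: ch].
Qed.

Lemma row_vec2 (v : 'rV[R]_2) : v = vec2 (v 0 0) (v 0 1).
Proof.
by apply/rowP => -[[|[|//]] i2]; rewrite mxE /=; congr (v 0 _); apply/val_inj.
Qed.

Lemma row_vec3 (v : 'rV[R]_3) : v = vec3 (v 0 0) (v 0 1) (v 0 2).
Proof.
by apply/rowP => -[[|[|[|//]]] i3]; rewrite mxE /=; congr (v 0 _); apply/val_inj.
Qed.

Lemma ler_coord_norm (n : nat) (v : 'rV[R]_n) j : `|v 0 j| <= `|v|.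
Proof. by rewrite [`|v|]mx_normrE (le_bigmax _ (fun i => `|v i.1 i.2|) (0, j)). Qed.

End Coordinates.

(** The coordinate y of the cylinder, carried to M as a function on the ambient
    space so that its regularity is visible there. On the disk,
    r = sqrt ((1 + y) / 2) gives y = 2 r^2 - 1. *)
Definition coord_height (R : realType) (M : surface) (v : 'rV[R]_3) : R :=
  if M is Disk then 2 * (v 0 0 ^+ 2 + v 0 1 ^+ 2) - 1 else v 0 2.

Definition height (R : realType) (M : surface) (x : pts R M) : R :=
  coord_height M (emb x).

(** All three surfaces are surfaces of revolution about the third axis; this is
    the profile, parametrized by the height. *)
Definition radius (R : realType) (M : surface) (y : R) : R :=
  match M with
  | Cylinder => 1
  | Disk => Num.sqrt ((1 + y) / 2)
  | Sphere => Num.sqrt (1 - y ^+ 2)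
  end.

(** * The height function *)

Section HeightTheory.
Context {R : realType} {M : surface}.
Implicit Types (x z : pts R M) (p : pts R Cylinder) (eta y s : R).

Lemma height_projM p : height (projM M p) = \val p.2.
Proof.
case: M; rewrite /height /coord_height /= !mxE //=.
rewrite !exprMn -mulrDr cos2Dsin2T mulr1 sqr_sqrtr; first by field.
by case: p => t [y yI] /=; move: yI; rewrite inE => /andP[? ?]; lra.
Qed.

Lemma projM_surj x : exists p, projM M p = x.
Proof.
case: M x => [x|[x xD]|[x xS]]; first by exists x.
- have := set_mem xD; rewrite /unit_disk /= sqnorm2E => x1.
  have [t [ct st]] := polar_coordinates (x 0 0) (x 0 1).
  have yI : segment R (2 * (x 0 0 ^+ 2 + x 0 1 ^+ 2) - 1).
    by apply/andP; split; have := sqr_ge0 (x 0 0); have := sqr_ge0 (x 0 1); nra.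
  exists (t, SigSub (mem_set yI)); apply/val_inj; rewrite /= [RHS]row_vec2.
  apply/rowP => j; rewrite !mxE.
  have -> : (1 + (2 * (x 0 0 ^+ 2 + x 0 1 ^+ 2) - 1)) / 2 = x 0 0 ^+ 2 + x 0 1 ^+ 2.
    by field.
  by case: j => -[|[|//]].
- have := set_mem xS; rewrite /unit_sphere /= sqnorm3E => x1.
  have [t [ct st]] := polar_coordinates (x 0 0) (x 0 1).
  have yI : segment R (x 0 2).
    by apply/andP; split; have := sqr_ge0 (x 0 0); have := sqr_ge0 (x 0 1); nra.
  exists (t, SigSub (mem_set yI)); apply/val_inj; rewrite /= [RHS]row_vec3.
  have -> : 1 - x 0 2 ^+ 2 = x 0 0 ^+ 2 + x 0 1 ^+ 2 by rewrite -x1 addrK.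
  by rewrite ct st.
Qed.

Lemma height_segment x : segment R (height x).
Proof.
by have [p <-] := projM_surj x; rewrite height_projM; exact: set_valP.
Qed.

Lemma projM_image_height (Q : R -> Prop) :
  projM M @` [set p | Q (\val p.2)] = [set x | Q (height x)].
Proof.
apply/seteqP; split=> [_ [p pQ <-]|x]; first by rewrite /= height_projM.
by have [p <-] := projM_surj x; rewrite /= height_projM => pQ; exists p.
Qed.

Lemma coreE eta : core M eta = [set x : pts R M | -1 + eta < height x < 1 - eta].
Proof. exact: (projM_image_height (fun y => -1 + eta < y < 1 - eta)). Qed.

Lemma checkME : checkM M = [set x : pts R M | -1 < height x < 1].
Proof. exact: (projM_image_height (fun y => -1 < y < 1)). Qed.

(** The constant comes from the disk, where
    y - y' = 2 ((a - a') (a + a') + (b - b') (b + b')) and all coordinates are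
    at most 1 in absolute value. *)
Lemma height_lipschitz x z : `|height x - height z| <= 8 * `|emb x - emb z|.
Proof.
have n0 : 0 <= `|emb x - emb z| by [].
have cd j : `|emb x 0 j - emb z 0 j| <= `|emb x - emb z|.
  by have := ler_coord_norm (emb x - emb z) j; rewrite !mxE.
case: M x z n0 cd => x z n0 cd; rewrite /height /coord_height; last 2 first.
- have := cd 0; have := cd 1.
  have bnd (w : pts R Disk) : emb w 0 0 ^+ 2 + emb w 0 1 ^+ 2 <= 1.
    by have := set_valP w; rewrite /unit_disk /= sqnorm2E !mxE.
  have := bnd x; have := bnd z.
  move: (emb x 0 0) (emb x 0 1) (emb z 0 0) (emb z 0 1) => a b c d.
  move: `|emb x - emb z| n0 => N n0 cd1 ab1 bdN acN.
  have sum2 (u v : R) : u ^+ 2 <= 1 -> v ^+ 2 <= 1 -> `|u + v| <= 2.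
    move=> u1 v1; rewrite ler_norml; apply/andP; split.
      by have := sqr_ge0 (u + 1); have := sqr_ge0 (v + 1); nra.
    by have := sqr_ge0 (u - 1); have := sqr_ge0 (v - 1); nra.
  have ac2 : `|a + c| <= 2 by apply: sum2; have := sqr_ge0 b; have := sqr_ge0 d; lra.
  have bd2 : `|b + d| <= 2 by apply: sum2; have := sqr_ge0 a; have := sqr_ge0 c; lra.
  have -> : 2 * (a ^+ 2 + b ^+ 2) - 1 - (2 * (c ^+ 2 + d ^+ 2) - 1) =
      2 * ((a - c) * (a + c) + (b - d) * (b + d)) by ring.
  have -> : 8 * N = 2 * (N * 2 + N * 2) by ring.
  rewrite normrM ger0_norm// ler_pM2l//; apply: (le_trans (ler_normD _ _)).
  by rewrite !normrM lerD// ler_pM.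
- by apply: (le_trans (cd 2)); lra.
- by apply: (le_trans (cd 2)); lra.
Qed.

Lemma coord_height_continuous : continuous (@coord_height R M).
Proof.
have cc j : continuous (fun v : 'rV[R]_3 => v 0 j) := @coord_continuous R 1 3 0 j.
have cd (X : topologicalType) (f g : X -> R) : continuous f -> continuous g ->
    continuous (fun s : X => 2 * (f s ^+ 2 + g s ^+ 2) - 1).
  move=> cf cg s; apply: cvgB; last exact: cvg_cst.
  apply: cvgM; first exact: cvg_cst.
  by apply: cvgD; [exact: cvgM (cf s) (cf s) | exact: cvgM (cg s) (cg s)].
by case: M; [exact: cc | exact: cd (cc 0) (cc 1) | exact: cc].
Qed.

Lemma height_continuous : continuous (@height R M).
Proof.
move=> x; apply: (@continuous_comp _ _ _ (@emb R M)).
  exact: (@initial_continuous (pts R M) _ (@emb R M)).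
exact: coord_height_continuous.
Qed.

Lemma emb_projM p : emb (projM M p) =
  vec3 (radius M (\val p.2) * cosT p.1) (radius M (\val p.2) * sinT p.1)
       (if M is Disk then 0 else \val p.2).
Proof. by case: M; rewrite /= ?mul1r // !mxE. Qed.

Lemma radius_continuous : continuous (@radius R M).
Proof.
have sq (f : R -> R) : continuous f -> continuous (fun y => Num.sqrt (f y)).
  by move=> cf y; apply: continuous_comp; [exact: cf | exact: sqrt_continuous].
have cd : continuous (fun y : R => Num.sqrt ((1 + y) / 2)).
  apply: sq => y; apply: cvgM; last exact: cvg_cst.
  by apply: cvgD; [exact: cvg_cst | exact: cvg_id].
have cs : continuous (fun y : R => Num.sqrt (1 - y ^+ 2)).
  by apply: sq => y; apply: cvgB; [exact: cvg_cst | exact: cvgM cvg_id cvg_id].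
by case: M; [exact: cst_continuous | exact: cd | exact: cs].
Qed.

(** * The complement of the extremal bicurve is connected, open and dense *)

Lemma segmentM_sin y s : segment R y -> segment R (y * sin s).
Proof.
move=> /andP[y1 y2]; rewrite /segment /= -ler_norml normrM.
by rewrite mulr_ile1 ?ler_norml ?y1 ?y2 ?sin_geN1 ?sin_le1.
Qed.

(** An arc from the point of angle 0 and height 0, at s = 0, to the image of p,
    at s = 1. The sine keeps the height in [-1, 1] for every real s, so the arc
    is defined and continuous on the whole line without truncation, while the
    height reaches an extreme value only for s = 1 as s varies in [0, 1]. *)
Definition spiral p s : pts R M :=
  projM M (turn (s * repr p.1),
           SigSub (mem_set (segmentM_sin (s * (pi / 2)) (set_valP p.2)))).

Lemma spiral0 p p' : spiral p 0 = spiral p' 0.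
Proof.
congr projM; congr (_, _); first by rewrite !mul0r.
by apply/val_inj; rewrite /= !mul0r sin0 !mulr0.
Qed.

Lemma spiral1 p : spiral p 1 = projM M p.
Proof.
case: p => t y; congr projM; congr (_, _); first by rewrite /= mul1r turn_repr.
by apply/val_inj; rewrite /= mul1r sin_pihalf mulr1.
Qed.

Lemma height_spiral p s : height (spiral p s) = \val p.2 * sin (s * (pi / 2)).
Proof. by rewrite height_projM. Qed.

Lemma spiral_checkM p s : 0 <= s < 1 -> checkM M (spiral p s).
Proof.
move=> /andP[s0 s1]; rewrite checkME /= -ltr_norml height_spiral normrM.
have pi0 := @pi_gt0 R.
have sn : `|sin (s * (pi / 2))| < 1.
  rewrite ltr_norml; have c0 : 0 < cos (s * (pi / 2)).
    by apply: cos_gt0_pihalf; apply/andP; split; nra.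
  by have cs := cos2Dsin2 (s * (pi / 2)); apply/andP; split; nra.
apply: le_lt_trans sn; rewrite ler_piMl// ler_norml.
by have := set_valP p.2.
Qed.

Lemma spiral_continuous p : continuous (spiral p).
Proof.
apply: (@continuous_comp_initial (pts R M) R _ (@emb R M)).
have comp (f g : R -> R) : continuous f -> continuous g -> continuous (g \o f).
  by move=> cf cg s; apply: continuous_comp; [exact: cf | exact: cg].
have ca c : continuous (fun s : R => s * c).
  by move=> s; apply: cvgM; [exact: cvg_id | exact: cvg_cst].
have ct : continuous (fun s : R => 2 * pi * (s * repr p.1)).
  by move=> s; apply: cvgM; [exact: cvg_cst | exact: ca].
have ccos : continuous (fun s => cosT (turn (s * repr p.1))).
  rewrite (_ : (fun s => _) = cos \o (fun s => 2 * pi * (s * repr p.1))).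
    exact: comp ct (@continuous_cos R).
  by apply/funext => s; rewrite cosT_turn.
have csin : continuous (fun s => sinT (turn (s * repr p.1))).
  rewrite (_ : (fun s => _) = sin \o (fun s => 2 * pi * (s * repr p.1))).
    exact: comp ct (@continuous_sin R).
  by apply/funext => s; rewrite sinT_turn.
have cy : continuous (fun s => \val p.2 * sin (s * (pi / 2))).
  move=> s; apply: cvgM; first exact: cvg_cst.
  exact: (comp _ _ (ca _) (@continuous_sin R)).
have cr : continuous (fun s => radius M (\val p.2 * sin (s * (pi / 2)))).
  exact: (comp _ _ cy (@radius_continuous)).
(* The third coordinate of the embedding. *)
pose third s : R := if M is Disk then 0 else \val p.2 * sin (s * (pi / 2)).
have c3 : continuous third.
  by rewrite /third; case: M; [exact: cy | exact: cst_continuous | exact: cy].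
rewrite (_ : _ \o _ = fun s => vec3
  (radius M (\val p.2 * sin (s * (pi / 2))) * cosT (turn (s * repr p.1)))
  (radius M (\val p.2 * sin (s * (pi / 2))) * sinT (turn (s * repr p.1)))
  (third s)).
  apply: vec3_continuous c3 => s; apply: cvgM.
  - exact: cr.
  - exact: ccos.
  - exact: cr.
  - exact: csin.
by apply/funext => s; rewrite /= emb_projM.
Qed.

Lemma open_checkM : open (checkM M : set (pts R M)).
Proof.
rewrite checkME -[X in open X]/(@height R M @^-1` [set y | -1 < y < 1]).
apply: open_comp => [x _|]; first exact: height_continuous.
have -> : [set y : R | -1 < y < 1] = `]-1, 1[%classic.
  by apply/seteqP; split=> y /=; rewrite in_itv.
exact: interval_open.
Qed.

Lemma closure_checkM : closure (checkM M) = [set: pts R M].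
Proof.
apply/seteqP; split=> // x _; have [p <-] := projM_surj x.
rewrite -spiral1 => B /(@spiral_continuous p 1) /nbhs_ballP[e /= e0 eB].
pose s := 1 - Num.min (e / 2) 1.
have m0 : 0 < Num.min (e / 2) 1 by rewrite lt_min divr_gt0/=.
have m1 : Num.min (e / 2) 1 <= 1 by rewrite ge_min lexx orbT.
have me : Num.min (e / 2) 1 <= e / 2 by rewrite ge_min lexx.
exists (spiral p s); split.
  by apply: spiral_checkM; rewrite /s; apply/andP; split; lra.
apply: eB; rewrite /ball /= /s opprB addrC subrK.
by rewrite ger0_norm ?(ltW m0)//; lra.
Qed.

Lemma connected_checkM : connected (checkM M : set (pts R M)).
Proof.
have -> : checkM M = \bigcup_(p in [set p | checkM M (projM M p)])
    (spiral p @` `[0, 1]%classic).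
  apply/seteqP; split=> [x|x [p px [s]]] /=.
    have [p <-] := projM_surj x => px; exists p => //.
    by exists 1; [rewrite /= in_itv /= ler01 lexx | exact: spiral1].
  rewrite in_itv /= le_eqVlt [s <= 1]le_eqVlt => /andP[s0 /orP[/eqP->|s1]] <-.
    by rewrite spiral1.
  by apply: spiral_checkM; rewrite s1 le_eqVlt s0.
apply: bigcup_connected.
  have seg0 : segment R 0 by rewrite /segment /= lerN10 ler01.
  pose p0 : pts R Cylinder := (0, SigSub (mem_set seg0)).
  exists (spiral p0 0) => p _; exists 0; last exact: spiral0.
  by rewrite /= in_itv /= ler01 lexx.
move=> p _; apply: connected_continuous_connected.
  exact/connected_intervalP/interval_is_interval.
exact/continuous_subspaceT/spiral_continuous.
Qed.

(** * The extremal bicurve *)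

Definition extremal_bicurve : set (pts R M) := projM M @` (level 1 `|` level (-1)).

Lemma extremal_bicurveE :
  extremal_bicurve = [set x | height x = 1 \/ height x = -1].
Proof. exact: (projM_image_height (fun y => y = 1 \/ y = -1)). Qed.

Lemma setC_extremal_bicurve : ~` extremal_bicurve = checkM M.
Proof.
rewrite extremal_bicurveE checkME; apply/seteqP; split=> x /=.
  have /andP[h1 h2] := height_segment x => h.
  by rewrite !lt_neqAle h1 h2 !andbT; apply/andP; split; apply/eqP => e; apply: h;
     [right|left].
by move=> /andP[h1 h2] [] h; move: h1 h2; rewrite h ltxx.
Qed.

(** The complement of the bicurve is its own unique component; being dense and
    open, its frontier is the whole bicurve. *)
Lemma outside_extremal_bicurve : outside extremal_bicurve = set0.
Proof.
apply/seteqP; split=> // x; apply; rewrite /between setC_extremal_bicurve.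
have [cx|] := pselect (checkM M x); last first.
  by rewrite -setC_extremal_bicurve; left; apply: contrapT.
right; split=> //; rewrite connected_component_id//; last exact: connected_checkM.
rewrite /frontier closure_checkM (interior_id _).1; last exact: open_checkM.
by rewrite setTD -setC_extremal_bicurve setCK.
Qed.

(** The projection semiconjugates the translation of the cylinder to the
    rotation of M; here the addition formulas enter. *)
Lemma rotation_projM a p : rotation a (projM M p) = projM M (p.1 + a, p.2).
Proof.
case: M => //; apply/val_inj/rowP => j; rewrite !mxE /= ?mxE /= cosTD sinTD.
  by case: j => -[|[|//]] j2 /=; ring.
by case: j => -[|[|[|//]]] j2 /=; ring.
Qed.

Lemma rotation_extremal_bicurve a : rotation a @` extremal_bicurve = extremal_bicurve.
Proof.
apply/seteqP; split=> [_ [_ [p pI <-] <-]|_ [p pI <-]].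
  by rewrite rotation_projM; exists (p.1 + a, p.2).
exists (projM M (p.1 - a, p.2)); first by exists (p.1 - a, p.2).
by rewrite rotation_projM /= subrK; case: p {pI}.
Qed.

(** Heights on the core differ by more than eta from the extreme values 1 and
    -1, and 8 is the Lipschitz constant of the height. *)
Lemma core_sub_tubeC eta : 0 < eta ->
  core M eta `<=` ~` tube extremal_bicurve (eta / 8).
Proof.
move=> eta0 x; rewrite coreE /= => /andP[h1 h2] [z + xz].
rewrite extremal_bicurveE /= => hz; have := height_lipschitz x z.
have : 8 * `|emb x - emb z| < eta by lra.
move=> /[swap] /le_lt_trans /[apply]; rewrite ltr_norml => /andP[].
by case: hz => ->; lra.
Qed.

(** The admissible extensions do not depend on the set, only the supremum of
    their derivatives does. *)
Lemma distC_sub k (K L : set (pts R M)) (f g : pts R M -> pts R M) :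
  K `<=` L -> (distC k K f g <= distC k L f g)%E.
Proof.
move=> KL; apply/ereal_infP => _ [F FE <-].
apply: le_trans; first by apply: ereal_inf_lbound; exists F.
apply: ge_ereal_sup => _ [->|[lx [sx Kx] <-]]; apply: ereal_sup_ubound.
  by left.
by right; exists lx => //; split=> //; exact: KL.
Qed.

End HeightTheory.

(** * The constant diffeotopy *)

Section ConstantDiffeotopy.
Context {R : realType}.

Lemma Ck_cst (V W : normedModType R) k (c : W) : Ck k (cst c : V -> W).
Proof.
elim: k c => [|k IH] c; first exact: cst_continuous.
split=> [x|v]; first exact: differentiable_cst.
by rewrite (_ : 'D_v (cst c) = cst 0) //; apply/funext => x; rewrite derive_cst.
Qed.

Lemma Cr_linear (V W : normedModType R) r (f : {linear V -> W}) :
  continuous f -> Cr r f.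
Proof.
move=> fc [|k] _ //; split=> [x|v]; first exact: linear_differentiable.
rewrite (_ : 'D_v f = cst (f v)); first exact: Ck_cst.
by apply/funext => x; rewrite deriveE ?diff_lin//; exact: linear_differentiable.
Qed.

Lemma inv_map_id (M : surface) : inv_map (@id (pts R M)) = id.
Proof.
by apply/funext => x; rewrite /inv_map; case: xgetP => [y _ ->|/(_ x)].
Qed.

Lemma diffeo_id (M : surface) r : diffeo r (@id (pts R M)).
Proof.
have c : Cr_map r (@id (pts R M)).
  by exists idfun => //; apply: Cr_linear => x; exact: cvg_id.
by split=> //; [exists id | rewrite inv_map_id].
Qed.

Lemma diffeotopy_id : diffeotopy (fun _ : R => @id (pts R Cylinder)).
Proof.
split.
- exists snd => //.
  by apply: Cr_linear => x; exact: cvg_snd.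
- by move=> *; exact: diffeo_id.
- exists set0; split=> //; exact: compact0.
Qed.

Lemma bicurve_extremal (M : surface) : bicurve (@extremal_bicurve R M).
Proof.
exists (level 1 `|` level (-1)) => //; exists (-1), 1, (fun=> id).
split=> //; [exact: diffeotopy_id | by rewrite !image_id].
Qed.

End ConstantDiffeotopy.

(** * Comparison of the schemes *)

Section Schemes.
Context {R : realType} {M : surface} {r : option nat}.
Local Notation symp_rel := (set_type (Symp_rel R M r)).

(** The complement of a thin tube contains the core, so a C^s ball over this
    complement lies inside the C^s ball over the core. *)
Lemma T_AbC_T_bicurve (U : set symp_rel) :
  T_AbC U -> T_bicurve (@extremal_bicurve R M) U.
Proof.
move=> oU f /oU[_ [s [eps [[eta /andP[eta0 _] <-] sr e0 UB]]]].
exists (~` tube (@extremal_bicurve R M) (eta / 8)), s, eps; split=> //.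
  by exists (eta / 8) => //=; rewrite divr_gt0.
move=> g fg; apply/UB/(le_lt_trans _ fg)/distC_sub.
exact: core_sub_tubeC.
Qed.

Lemma AbC_scheme_star (U : symp_rel -> QZ R -> set symp_rel)
    (nu : symp_rel -> QZ R -> R) : AbC_scheme U nu -> AbC_star_scheme U nu.
Proof.
move=> [Unu hU cvgU]; split=> // h a.
  have [/T_AbC_T_bicurve TU nu0] := Unu h a; split=> //.
  by exists (@extremal_bicurve R M); [exact: bicurve_extremal | exact: TU].
have [h' Uh' h'E] := hU h a; exists h'; split=> //.
exists (@extremal_bicurve R M); split.
- exact: bicurve_extremal.
- exact: rotation_extremal_bicurve.
- by apply: T_AbC_T_bicurve; case: (Unu h a).
- by move=> x; rewrite outside_extremal_bicurve.
Qed.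

End Schemes.

Theorem proposition2p13 (R : realType) (M : surface) (r : option nat) :
  (forall (U : set_type (Symp_rel R M r) -> QZ R -> set (set_type (Symp_rel R M r)))
          (nu : set_type (Symp_rel R M r) -> QZ R -> R),
     AbC_scheme U nu -> AbC_star_scheme U nu) /\
  (forall P : set (set_type (Symp R M r)),
     AbC_realizable P -> AbC_star_realizable P).
Proof.
split=> [U nu|P [Pconj [U [nu [sU PU]]]]]; first exact: AbC_scheme_star.
by split=> //; exists U, nu; split=> //; exact: AbC_scheme_star.
Qed.
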